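(* Let $T=\{2143,2341,2413\}$. Then $$F_T(x)=\frac{1-4x+3x^2-x^3}{1-5x+6x^2-3x^3}.$$
   Context: $S_n(T)$ denotes the set of permutations $\pi$ of $[n]=\{1,\dots,n\}$ (one-line notation) that avoid every pattern $\tau\in T$, i.e. no subsequence of $\pi$ is order-isomorphic to $\tau$. $F_T(x)=\sum_{n\ge 0}|S_n(T)|x^n$, a formal power series, with $|S_0(T)|=1$. *)

(* Defs.v *)
From mathcomp Require Import all_boot all_order all_fingroup all_algebra.

Set Implicit Arguments.
Unset Strict Implicit.
Unset Printing Implicit Defensive.

Import GRing.Theory.

(* A pattern is given in one-line notation as a word; only the relative order
   of its letters matters, so the 0-based values of 'S_n are harmless. *)
Definition contains (n : nat) (pi : 'S_n) (tau : seq nat) : bool :=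
  [exists f : {ffun 'I_(size tau) -> 'I_n},
    [forall i : 'I_(size tau), forall j : 'I_(size tau),
       (i < j) ==> (f i < f j)] &&
    [forall i : 'I_(size tau), forall j : 'I_(size tau),
       (pi (f i) < pi (f j)) == (nth 0 tau i < nth 0 tau j)]].

Definition avoiders (n : nat) (T : seq (seq nat)) : {set 'S_n} :=
  [set pi | all (fun tau => ~~ contains pi tau) T].

Local Open Scope ring_scope.

Section FormalPowerSeries.
Variable R : fieldType.

(* A formal power series is its sequence of coefficients; two series are equal
   when they agree pointwise (=1). *)
Definition fps := nat -> R.

Definition fps_of_poly (p : {poly R}) : fps := fun n => p`_n.

Definition fps_mul (a b : fps) : fps :=
  fun n => \sum_(i < n.+1) a i * b (n - i)%N.

(* The first n coefficients of a / b, by long division. *)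
Fixpoint fps_div_seq (a b : fps) (n : nat) : seq R :=
  if n is m.+1 then
    let c := fps_div_seq a b m in
    rcons c ((a m - \sum_(i < m) c`_i * b (m - i)%N) / b 0)
  else [::].

(* Meaningful when b 0 != 0: see fps_divK and fps_div_unique below. *)
Definition fps_div (a b : fps) : fps := fun n => (fps_div_seq a b n.+1)`_n.

Lemma size_fps_div_seq a b n : size (fps_div_seq a b n) = n.
Proof. by elim: n => //= n IHn; rewrite size_rcons IHn. Qed.

Lemma nth_fps_div_seq a b n i :
  (i < n)%N -> (fps_div_seq a b n)`_i = fps_div a b i.
Proof.
elim: n => // n IHn; rewrite ltnS leq_eqVlt => /orP[/eqP-> //|lt_in].
by rewrite /= nth_rcons size_fps_div_seq lt_in IHn.
Qed.

Lemma fps_divE a b n :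
  fps_div a b n =
  (a n - \sum_(i < n) fps_div a b i * b (n - i)%N) / b 0.
Proof.
rewrite {1}/fps_div /= nth_rcons size_fps_div_seq ltnn eqxx.
by under eq_bigr => i _ do rewrite nth_fps_div_seq //.
Qed.

Lemma fps_divK a b : b 0 != 0 -> fps_mul (fps_div a b) b =1 a.
Proof.
move=> b0 n; rewrite /fps_mul big_ord_recr /= subnn fps_divE divfK //.
by rewrite addrC subrK.
Qed.

Lemma fps_div_unique a b c : b 0 != 0 -> fps_mul c b =1 a -> c =1 fps_div a b.
Proof.
move=> b0 cb n; have [m] := ubnP n; elim: m n => // m IHm n lt_nm.
rewrite fps_divE -(cb n) /fps_mul big_ord_recr /= subnn.
rewrite (eq_bigr (fun i : 'I_n => fps_div a b i * b (n - i)%N)); last first.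
  by move=> i _; rewrite IHm // (leq_trans (ltn_ord i)).
by rewrite addrC addrK mulfK.
Qed.

End FormalPowerSeries.

Definition avoid_gf (T : seq (seq nat)) : fps rat :=
  fun n => #|avoiders n T|%:R.

(* Main.v *)
Require Import Defs.
From mathcomp Require Import all_boot all_order all_fingroup all_algebra.
From mathcomp Require Import zify lra.

Set Implicit Arguments.
Unset Strict Implicit.
Unset Printing Implicit Defensive.

(* All three patterns start with their second smallest letter, so a permutation
   of n + 1 letters avoids them iff, removing its first letter k (letters are
   0-based), what remains avoids them and contains no s, a, b with s < k < a < b
   in one of the orders s b a, a b s, b s a.  If the largest letter p comes last,
   it can be removed without consequence.  If it does not and there are smaller
   letters as well as at least two larger letters than k, these orders force
   all larger letters to come before all smaller ones, in decreasing order, while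
   the smaller ones form an arbitrary avoider.  Hence the number C(k, n) of
   avoiders of length n + 1 starting with k satisfies
   C(k, n + 1) = C(k, n) + a_k for 0 < k < n, and C(k, n) = a_n for
   k = 0, n - 1, n.  Summing over k and taking differences yields
   a_(n+4) = 5 a_(n+3) - 6 a_(n+2) + 3 a_(n+1). *)

(** * Subsequences of a word with a given property *)

Fixpoint has_sub (T : Type) (P : pred (seq T)) (s : seq T) : bool :=
  if s is x :: s' then has_sub P s' || has_sub (fun t => P (x :: t)) s'
  else P [::].

(** The recursion [has_sub] evaluates on concrete words, which yields the initial counts; all other
    arguments go through this view. *)
Lemma has_subP (T : eqType) (P : pred (seq T)) (s : seq T) :
  reflect (exists2 t, subseq t s & P t) (has_sub P s).
Proof.
elim: s P => [|x s IHs] P /=.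
  by apply: (iffP idP) => [P0|[[]]] //; exists [::].
apply: (iffP orP) => [[/IHs[t st Pt]|/IHs[t st Pt]]|[t]].
- by exists t => //; exact: (subseq_trans st (subseq_cons s x)).
- by exists (x :: t) => //=; rewrite eqxx.
case: t => [|y t] /=; first by left; apply/IHs; exists [::]; rewrite ?sub0seq.
case: eqP => [->|_] st Pt; first by right; apply/IHs; exists t.
by left; apply/IHs; exists (y :: t).
Qed.

Lemma eq_in_has_sub (T : eqType) (P Q : pred (seq T)) (s : seq T) :
  (forall t, subseq t s -> P t = Q t) -> has_sub P s = has_sub Q s.
Proof.
by move=> eqPQ; apply/has_subP/has_subP=> -[t st Pt]; exists t => //;
   rewrite ?eqPQ // -eqPQ.
Qed.

Lemma has_sub_map (T U : Type) (f : T -> U) (P : pred (seq U)) (s : seq T) :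
  has_sub P (map f s) = has_sub (fun t => P (map f t)) s.
Proof. by elim: s P => //= x s IHs P; rewrite !IHs. Qed.

Lemma has_sub_rcons (T : Type) (P : pred (seq T)) (s : seq T) (x : T) :
  has_sub P (rcons s x) = has_sub P s || has_sub (fun t => P (rcons t x)) s.
Proof. by elim: s P => //= y s IHs P; rewrite !IHs orbACA. Qed.

Lemma has_sub0 (T : Type) (s : seq T) : has_sub (fun _ => false) s = false.
Proof. by elim: s => //= _ s ->. Qed.

Lemma pairwise_subseq2 (T : eqType) (r : rel T) (s : seq T) :
  (forall x y, subseq [:: x; y] s -> r x y) -> pairwise r s.
Proof.
elim: s => //= x s IHs rs; apply/andP; split.
  by apply/allP=> y s_y; apply: rs; rewrite eqxx sub1seq.
by apply: IHs => y z syz; apply: rs; apply: (subseq_trans syz (subseq_cons s x)).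
Qed.

(** * Permutations as words *)

Definition order_iso (t tau : seq nat) : bool :=
  (size t == size tau) &&
  [forall i : 'I_(size tau), forall j : 'I_(size tau),
     (nth 0 t i < nth 0 t j) == (nth 0 tau i < nth 0 tau j)].

Definition word (n : nat) (pi : 'S_n) : seq nat :=
  [seq val (pi i) | i <- enum 'I_n].

Lemma ord_enum_sorted n : sorted (fun i j : 'I_n => i < j) (enum 'I_n).
Proof.
have := iota_ltn_sorted 0 n; rewrite -val_enum_ord sorted_map.
by apply: sub_sorted.
Qed.

(** An increasing [f] and a choice of positions are the same data: the values of [f] form a
    subsequence of [enum 'I_n], and conversely a mask selects the values of [f]. *)
Lemma contains_word n (pi : 'S_n) tau :
  contains pi tau = has_sub (fun t => order_iso t tau) (word pi).
Proof.
have lt_tr : transitive (fun i j : 'I_n => i < j) by move=> j i k; apply: ltn_trans.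
apply/existsP/has_subP => [[f /andP[/forallP fmono /forallP fpi]]|[t]].
  pose r := [seq f i | i <- enum 'I_(size tau)].
  have r_sub : subseq r (enum 'I_n).
    (* Both lists are increasing and have the same elements. *)
    rewrite (_ : r = [seq i <- enum 'I_n | i \in r]) ?filter_subseq //.
    apply: (irr_sorted_eq lt_tr) => [i|||]; first exact: ltnn.
    - rewrite sorted_map; apply: sub_sorted (ord_enum_sorted _) => i j lt_ij.
      by have /forallP/(_ j)/implyP := fmono i; apply.
    - exact: sorted_filter (ord_enum_sorted _).
    - by move=> i; rewrite mem_filter mem_enum andbT.
  exists [seq val (pi i) | i <- r]; first exact: map_subseq.
  rewrite /order_iso size_map {1}/r size_map size_enum_ord eqxx /=.
  apply/forallP=> i; apply/forallP=> j; have /forallP/(_ j)/eqP <- := fpi i.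
  have nthE (l : 'I_(size tau)) : nth 0 [seq val (pi i) | i <- r] l = pi (f l).
    rewrite /r -map_comp (nth_map l) ?size_enum_ord //=.
    by rewrite nth_ord_enum.
  by rewrite !nthE.
case/subseqP=> m sz_m ->; rewrite /word -map_mask; set r := mask m _.
have r_sorted : sorted (fun i j : 'I_n => i < j) r.
  exact: subseq_sorted (mask_subseq _ _) (ord_enum_sorted n).
case/andP; rewrite size_map => /eqP sz_r /forallP r_iso.
pose f := [ffun i : 'I_(size tau) => tnth (in_tuple r) (cast_ord (esym sz_r) i)].
have fE x0 i : f i = nth x0 r i by rewrite ffunE (tnth_nth x0).
exists f; apply/andP; split; apply/forallP=> i; apply/forallP=> j.
  have x0 := f i; apply/implyP=> lt_ij; rewrite !(fE x0).
  by apply: (sorted_ltn_nth lt_tr) => //; rewrite inE sz_r.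
have /forallP/(_ j)/eqP <- := r_iso i.
by have x0 := f i; rewrite !(nth_map x0) ?sz_r // -!fE.
Qed.

Lemma nth_word n (pi : 'S_n) (i : 'I_n) : nth 0 (word pi) i = pi i.
Proof. by rewrite (nth_map i 0) ?size_enum_ord // nth_ord_enum. Qed.

Lemma word_inj n : injective (@word n).
Proof.
by move=> p q eq_pq; apply/permP=> i; apply/val_inj; rewrite /= -!nth_word eq_pq.
Qed.

Lemma uniq_sub_perm (T : eqType) (s1 s2 : seq T) :
  uniq s1 -> uniq s2 -> {subset s1 <= s2} -> size s2 <= size s1 -> perm_eq s1 s2.
Proof.
move=> U1 U2 s12 sz21; apply: uniq_perm => //.
by have [] := uniq_min_size U1 s12 sz21.
Qed.

Lemma perm_word n (pi : 'S_n) : perm_eq (word pi) (iota 0 n).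
Proof.
apply: uniq_sub_perm; rewrite ?iota_uniq //.
- by rewrite map_inj_uniq ?enum_uniq // => i j /val_inj/perm_inj.
- by move=> _ /mapP[i _ ->]; rewrite mem_iota /=.
- by rewrite size_iota size_map size_enum_ord.
Qed.

(** Injectivity of [word] and the common size n! suffice, so no inverse is built. *)
Lemma perm_words n :
  perm_eq [seq word pi | pi <- enum 'S_n] (permutations (iota 0 n)).
Proof.
apply: uniq_sub_perm; rewrite ?permutations_uniq //.
- by rewrite map_inj_uniq ?enum_uniq //; apply: word_inj.
- by move=> _ /mapP[pi _ ->]; rewrite mem_permutations perm_word.
- by rewrite size_permutations ?iota_uniq // size_iota size_map -cardE card_Sn.
Qed.

Lemma card_avoiders n T :
  #|avoiders n T| =
  count (fun s => all (fun tau => ~~ has_sub (fun t => order_iso t tau) s) T)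
        (permutations (iota 0 n)).
Proof.
rewrite -(seq.permP (perm_words n)) count_map cardE /enum_mem size_filter.
rewrite count_filter; apply: eq_count => pi /=; rewrite !inE andbT.
by apply: eq_all => tau; rewrite contains_word.
Qed.

(** * The three patterns as inequalities between letters *)

Lemma order_isoE t tau :
  order_iso t tau =
  (size t == size tau) &&
  all (fun i => all (fun j => (nth 0 t i < nth 0 t j) == (nth 0 tau i < nth 0 tau j))
    (iota 0 (size tau))) (iota 0 (size tau)).
Proof.
congr andb; apply/forallP/allP => [iso i|iso i].
  rewrite mem_iota => lt_i; apply/allP=> j; rewrite mem_iota => lt_j.
  by have /forallP/(_ (Ordinal lt_j)) := iso (Ordinal lt_i).
have i_in : (i : nat) \in iota 0 (size tau) by rewrite mem_iota ltn_ord.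
have /allP/= iso_i := iso _ i_in.
by apply/forallP=> j; apply: iso_i; rewrite mem_iota ltn_ord.
Qed.

(** The disjuncts are 2143, 2341 and 2413, in this order, each a chain from the smallest letter to
    the largest. *)
Definition forbidden (t : seq nat) : bool :=
  if t is [:: x; y; z; w] then
    [|| (y < x < w) && (w < z), (w < x < y) && (y < z) | (z < x < w) && (w < y)]
  else false.

Lemma forbiddenE t :
  forbidden t =
  has (order_iso t) [:: [:: 2; 1; 4; 3]; [:: 2; 3; 4; 1]; [:: 2; 4; 1; 3]].
Proof.
rewrite /= !order_isoE orbF; case: t => [|x [|y [|z [|w [|? ?]]]]] //=.
by rewrite !ltnn; lia.
Qed.

Definition avoiding (s : seq nat) : bool := ~~ has_sub forbidden s.

Lemma avoidingE s :
  avoiding s =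
  all (fun tau => ~~ has_sub (fun t => order_iso t tau) s)
      [:: [:: 2; 1; 4; 3]; [:: 2; 3; 4; 1]; [:: 2; 4; 1; 3]].
Proof.
rewrite -[RHS]negbK -has_predC; congr negb; apply/has_subP/hasP.
  case=> t st; rewrite forbiddenE => /hasP[tau T_tau iso]; exists tau => //=.
  by rewrite negbK; apply/has_subP; exists t.
case=> tau T_tau /=; rewrite negbK => /has_subP[t st iso]; exists t => //.
by rewrite forbiddenE; apply/hasP; exists tau.
Qed.

(* The words over n + 1 letters starting with [k] are the [k :: map (bump k) s]
   for [s] over n letters, so letters of [s] that are [>= k] stand for those
   greater than the first one. *)
Definition dodges (k : nat) (s : seq nat) : bool :=
  ~~ has_sub (fun t => forbidden (k :: map (bump k) t)) s.

(** * Removing the first letter or the largest letter *)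

Lemma ltn_bump k i j : (bump k i < bump k j) = (i < j).
Proof. by rewrite !ltnNge leq_bump2. Qed.

Lemma forbidden_bump k t : forbidden (map (bump k) t) = forbidden t.
Proof. by case: t => [|x [|y [|z [|w [|? ?]]]]] //=; rewrite !ltn_bump. Qed.

Lemma forbidden_cons_bump k y z w :
  forbidden (k :: map (bump k) [:: y; z; w]) =
  [|| (y < k <= w) && (w < z), (w < k <= y) && (y < z) | (z < k <= w) && (w < y)].
Proof.
rewrite /= !ltn_bump; have lt_bump i : (bump k i < k) = (i < k) by rewrite /bump; lia.
have gt_bump i : (k < bump k i) = (k <= i) by rewrite /bump; lia.
by rewrite !lt_bump !gt_bump.
Qed.

Lemma avoiding_cons_bump k s :
  avoiding (k :: map (bump k) s) = avoiding s && dodges k s.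
Proof.
rewrite /avoiding /dodges /= negb_or !has_sub_map; congr (~~ _ && _).
by apply: eq_in_has_sub => t _; apply: forbidden_bump.
Qed.

(** No pattern begins with its largest letter. *)
Lemma avoiding_cons_max x s : all (gtn x) s -> avoiding (x :: s) = avoiding s.
Proof.
move=> /allP max_x; rewrite /avoiding /=.
rewrite [X in _ || X](@eq_in_has_sub _ _ (fun=> false)) ?has_sub0 ?orbF //.
move=> [|y [|z [|w [|? ?]]]] //= /mem_subseq sub; move: (@max_x y) (@max_x z) (@max_x w).
by rewrite /= !sub ?inE ?eqxx ?orbT // => /(_ isT) ? /(_ isT) ? /(_ isT) ?; lia.
Qed.

(** No pattern ends with its largest letter. *)
Lemma avoiding_rcons_max x s : all (gtn x) s -> avoiding (rcons s x) = avoiding s.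
Proof.
move=> /allP max_x; rewrite /avoiding has_sub_rcons.
rewrite [X in _ || X](@eq_in_has_sub _ _ (fun=> false)) ?has_sub0 ?orbF //.
move=> [|y [|z [|w [|? [|? ?]]]]] //= /mem_subseq sub; move: (@max_x y) (@max_x z) (@max_x w).
by rewrite /= !sub ?inE ?eqxx ?orbT // => /(_ isT) ? /(_ isT) ? /(_ isT) ?; lia.
Qed.

Lemma dodgesP k s :
  reflect (forall x y z, subseq [:: x; y; z] s ->
     [&& ~~ ((x < k <= z) && (z < y)), ~~ ((z < k <= x) && (x < y)) &
         ~~ ((y < k <= z) && (z < x))]) (dodges k s).
Proof.
apply: (iffP negP) => [dk x y z sub|dk /has_subP[[|x [|y [|z [|? ?]]]] sub]] //.
  rewrite -!negb_or -forbidden_cons_bump; apply/negP=> fk; apply: dk.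
  by apply/has_subP; exists [:: x; y; z].
by have:= dk _ _ _ sub; rewrite -!negb_or -forbidden_cons_bump => /negP.
Qed.

(** None of the orders s b a, a b s, b s a ends with its largest letter b. *)
Lemma dodges_rcons_max k x s : all (gtn x) s -> dodges k (rcons s x) = dodges k s.
Proof.
move=> /allP max_x; rewrite /dodges has_sub_rcons.
rewrite [X in _ || X](@eq_in_has_sub _ _ (fun=> false)) ?has_sub0 ?orbF //.
move=> [|y [|z [|w [|? ?]]]] // /mem_subseq sub.
rewrite [rcons _ _]/= forbidden_cons_bump; move: (@max_x y) (@max_x z).
by rewrite /= !sub ?inE ?eqxx ?orbT // => /(_ isT) ? /(_ isT) ?; lia.
Qed.

Lemma dodges0 s : dodges 0 s.
Proof. by apply/dodgesP => x y z _; lia. Qed.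

(** An occurrence needs k <= a < b, hence a letter b exceeding [k]. *)
Lemma dodges_le k s : all (geq k) s -> dodges k s.
Proof.
move=> /allP le_k; apply/dodgesP => x y z /mem_subseq sub.
move: (@le_k x) (@le_k y) (@le_k z).
by rewrite /= !sub ?inE ?eqxx ?orbT // => /(_ isT) ? /(_ isT) ? /(_ isT) ?; lia.
Qed.

(** * Words whose largest letter is not last *)

(** Imposed pairwise on a word, this puts the letters [>= k] first, in decreasing order, and leaves
    the order of the smaller ones free. *)
Definition descends_from (k : nat) : rel nat := fun x y => (k <= y) ==> (y < x).

Lemma dodges_descends k s : pairwise (descends_from k) s -> dodges k s.
Proof.
move=> ds; apply/dodgesP => x y z /subseq_pairwise/(_ ds) /=.
by rewrite /descends_from; lia.
Qed.

(** The letter [p], playing b, forces [s1] to be empty and then the large letters to precede the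
    small ones; 0, playing s, makes the large ones decrease. *)
Lemma dodges_max_last k p s1 s2 :
  0 < k < p -> perm_eq (s1 ++ p :: s2) (iota 0 p.+1) -> dodges k (s1 ++ p :: s2) ->
  s2 != [::] -> pairwise (descends_from k) (s1 ++ p :: s2).
Proof.
move=> /andP[k_gt0 lt_kp] s_perm /dodgesP dk s2_neq0.
have Us : uniq (s1 ++ p :: s2) by rewrite (perm_uniq s_perm) iota_uniq.
have /perm_mem mem_s : perm_eq (s1 ++ s2) (iota 0 p).
  rewrite -(perm_cons p) -cat1s perm_catCA; apply: perm_trans s_perm _.
  by rewrite -addn1 iotaD /= add0n perm_catC.
have lt_p i : i \in s1 ++ s2 -> i < p by rewrite mem_s mem_iota.
have s_k : k \in s1 ++ s2 by rewrite mem_s mem_iota.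
have s_0 : 0 \in s1 ++ s2 by rewrite mem_s mem_iota /=; lia.
(* With [p] between them, letters on different sides of [k] would form s b a or a b s. *)
have same_side a b : a \in s1 -> b \in s2 -> (k <= a) = (k <= b).
  move=> s1a s2b; have /dk : subseq [:: a; p; b] (s1 ++ p :: s2).
    by rewrite (@cat_subseq _ [:: a]) ?sub1seq //= eqxx sub1seq.
  by have := lt_p a; have := lt_p b; rewrite !mem_cat s1a s2b orbT; lia.
have [b s2b] : exists b, b \in s2.
  by case: s2 s2_neq0 {dk mem_s s_perm lt_p s_k s_0 same_side Us} => // b ? _; exists b; rewrite mem_head.
(* Otherwise all letters but [p] lie on the same side of [k], which 0 and [k] itself contradict. *)
have s1_nil : s1 = [::].
  case: s1 s_k s_0 same_side {dk mem_s s_perm lt_p Us} => // a s1' s_k s_0 same_side.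
  have s1a : a \in a :: s1' by rewrite mem_head.
  have := same_side _ _ s1a s2b.
  move: s_k s_0; rewrite !(mem_cat _ (_ :: _)).
  by case/orP=> [/same_side/(_ s2b)|/(same_side _ _ s1a)] ?;
     case/orP=> [/same_side/(_ s2b)|/(same_side _ _ s1a)] ?; lia.
subst s1; rewrite /= in Us dk lt_p s_0 *; case/andP: Us => _ Us; apply/andP; split.
  by apply/allP=> i /lt_p lt_ip; apply/implyP.
(* Now [p] comes first, so b s a excludes a small letter before a large one. *)
have large_first a c : subseq [:: a; c] s2 -> k <= c -> k <= a.
  move=> s2ac le_kc; have /dk : subseq [:: p; a; c] (p :: s2) by rewrite /= eqxx.
  have := lt_p c; rewrite (mem_subseq s2ac) ?inE ?eqxx ?orbT // => /(_ isT).
  by lia.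
(* Only small letters follow 0, so 0 comes after every large letter and can serve as s in a b s. *)
case/splitPr: s_0 Us dk large_first {mem_s s_perm lt_p s_k same_side s2_neq0 s2b} => s1 s3 Us dk large_first.
have small i : i \in 0 :: s3 -> i < k.
  rewrite inE => /predU1P[-> //|s3i]; rewrite ltnNge; apply/negP=> /(large_first 0).
  rewrite leqn0 => le_k0; suff /le_k0 : subseq [:: 0; i] (s1 ++ 0 :: s3) by lia.
  by rewrite (@cat_subseq _ [::]) ?sub0seq //= sub1seq.
have small_r a : all (descends_from k a) (0 :: s3).
  by apply/allP=> i /small; rewrite /descends_from; lia.
rewrite pairwise_cat; apply/and3P; split.
- by apply/allP=> a _; apply: small_r.
- apply: pairwise_subseq2 => a c s1ac; apply/implyP=> le_kc.
  have le_ka : k <= a.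
    by apply: large_first le_kc; apply: subseq_trans s1ac (prefix_subseq _ _).
  have /dk : subseq [:: a; c; 0] (p :: s1 ++ 0 :: s3).
    apply: subseq_trans (subseq_cons _ p).
    by rewrite (@cat_subseq _ [:: a; c] [:: 0]) //= sub0seq.
  have /= := subseq_uniq (subseq_trans s1ac (prefix_subseq _ (0 :: s3))) Us.
  by rewrite inE; lia.
by elim: (0 :: s3) small_r => //= a s IHs small_r; rewrite IHs ?andbT;
   [have /andP[] := small_r a | move=> c; have /andP[] := small_r c].
Qed.

Lemma descends_cat k s :
  pairwise (descends_from k) s ->
  s = [seq x <- s | k <= x] ++ [seq x <- s | x < k].
Proof.
elim: s => //= x s IHs /andP[/allP dx /IHs eq_s].
case: leqP => [le_kx|lt_xk] /=; first by rewrite -eq_s.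
rewrite (_ : [seq y <- s | k <= y] = [::]) in eq_s *; first by rewrite {1}eq_s.
apply/eqP; rewrite -(negbK (_ == _)) -has_filter; apply/hasPn=> y s_y.
by apply/negP=> le_ky; have := dx y s_y; rewrite /descends_from le_ky /=; lia.
Qed.

Lemma mem_descending k n i : (i \in rev (iota k (n - k))) = (k <= i < n).
Proof. by rewrite mem_rev mem_iota; lia. Qed.

(** The letters k, ..., n - 1 have only one decreasing arrangement, so the small letters determine
    the word. *)
Lemma descends_form k n s :
  perm_eq s (iota 0 n) -> pairwise (descends_from k) s ->
  s = rev (iota k (n - k)) ++ [seq x <- s | x < k].
Proof.
move=> s_perm ds; rewrite {1}(descends_cat ds); congr cat.
have gtn_tr : transitive gtn by move=> y x z /=; lia.
apply: (irr_sorted_eq gtn_tr) => [x|||x]; first exact: ltnn.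
- rewrite (sorted_pairwise gtn_tr); have := pairwise_filter (leq k) ds.
  have : all (leq k) [seq x <- s | k <= x] by apply: filter_all.
  elim: [seq _ <- s | _] => //= x r IHr /andP[_ le_kr] /andP[dx /(IHr le_kr)->].
  rewrite andbT; apply/allP=> y r_y; have := allP dx y r_y.
  by rewrite /descends_from (allP le_kr).
- by rewrite rev_sorted iota_ltn_sorted.
- by rewrite mem_filter mem_descending (perm_mem s_perm) mem_iota.
Qed.

Lemma perm_small k n s :
  k <= n -> perm_eq s (iota 0 n) -> perm_eq [seq x <- s | x < k] (iota 0 k).
Proof.
move=> le_kn s_perm; apply: uniq_perm => [||x]; rewrite ?iota_uniq //.
  by rewrite filter_uniq // (perm_uniq s_perm) iota_uniq.
by rewrite mem_filter (perm_mem s_perm) !mem_iota; lia.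
Qed.

Lemma perm_descending_cat k n s :
  k <= n -> perm_eq s (iota 0 k) -> perm_eq (rev (iota k (n - k)) ++ s) (iota 0 n).
Proof.
move=> le_kn s_perm; rewrite -{2}(subnKC le_kn) iotaD perm_catC.
by rewrite perm_cat // perm_rev.
Qed.

Lemma descends_descending_cat k n s :
  all (gtn k) s -> pairwise (descends_from k) (rev (iota k n) ++ s).
Proof.
move=> /allP s_small; have ds a r : {subset r <= s} -> all (descends_from k a) r.
  move=> rs; apply/allP=> y /rs/s_small /= lt_yk; apply/implyP; lia.
rewrite pairwise_cat; apply/and3P; split.
- by apply/allP=> a _; apply: ds.
- have gtn_tr : transitive gtn by move=> y x z /=; lia.
  have : sorted gtn (rev (iota k n)) by rewrite rev_sorted iota_ltn_sorted.
  rewrite (sorted_pairwise gtn_tr).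
  by apply: sub_pairwise => x y /= lt_yx; apply/implyP.
have: {subset s <= s} by [].
elim: {1 3}s => //= x r IHr rs; rewrite ds => [|y r_y]; last by rewrite rs ?inE ?r_y ?orbT.
by apply: IHr => y r_y; rewrite rs ?inE ?r_y ?orbT.
Qed.

(** Each letter of the prefix exceeds everything after it, so [avoiding_cons_max] strips them one by
    one. *)
Lemma avoiding_descending_cat k n s :
  all (gtn k) s -> avoiding (rev (iota k n) ++ s) = avoiding s.
Proof.
move=> /allP s_small; elim: n => // n IHn.
rewrite -addn1 iotaD rev_cat /= avoiding_cons_max //.
apply/allP=> i; rewrite mem_cat mem_rev mem_iota => /orP[|/s_small] /=; lia.
Qed.

(** * Counting avoiders by their first letter *)

Definition nb_avoiding (n : nat) : nat := count avoiding (permutations (iota 0 n)).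

(** For [k <= n] this is C(k, n): the words counted are those left after removing the first letter
    [k]. *)
Definition nb_head (k n : nat) : nat :=
  count (fun s => avoiding s && dodges k s) (permutations (iota 0 n)).

Lemma perm_iota_all n s : perm_eq s (iota 0 n) -> all (gtn n) s.
Proof. by move=> s_perm; apply/allP=> i; rewrite (perm_mem s_perm) mem_iota. Qed.

Lemma bump_inj k : injective (bump k).
Proof. by move=> i j; apply: (can_inj (bumpK k)). Qed.

Lemma perm_cons_bump k n s :
  k <= n -> perm_eq s (iota 0 n) -> perm_eq (k :: map (bump k) s) (iota 0 n.+1).
Proof.
move=> le_kn s_perm; apply: uniq_sub_perm; rewrite ?iota_uniq //.
- rewrite /= map_inj_uniq ?(perm_uniq s_perm) ?iota_uniq ?andbT; last exact: bump_inj.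
  by apply/negP=> /mapP[i _ /eqP]; rewrite (negPf (neq_bump k i)).
- move=> i; rewrite inE mem_iota => /predU1P[->|/mapP[j]] //=.
  by rewrite (perm_mem s_perm) mem_iota /bump => /= ? ->; lia.
- by rewrite /= size_map (perm_size s_perm) !size_iota.
Qed.

(** Injectivity and (n + 1) * n! = (n + 1)! replace a proof of surjectivity. *)
Lemma perm_head n :
  perm_eq [seq k :: map (bump k) s | k <- iota 0 n.+1, s <- permutations (iota 0 n)]
          (permutations (iota 0 n.+1)).
Proof.
apply: uniq_sub_perm; rewrite ?permutations_uniq //.
- apply: allpairs_uniq; rewrite ?permutations_uniq ?iota_uniq //.
  move=> [k s] [l t] _ _ /= [<- eq_st]; congr pair.
  exact: inj_map (@bump_inj k) _ _ eq_st.
- move=> w /allpairsP[p []]; rewrite mem_iota !mem_permutations => k_lt s_perm ->.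
  exact: perm_cons_bump.
- by rewrite size_allpairs !size_permutations ?iota_uniq // !size_iota factS.
Qed.

Lemma nb_avoidingS n : nb_avoiding n.+1 = \sum_(0 <= k < n.+1) nb_head k n.
Proof.
rewrite /nb_avoiding -(seq.permP (perm_head n)) count_flatten -map_comp.
rewrite sumnE big_map /index_iota subn0; apply: eq_bigr => k _ /=.
by rewrite count_map; apply: eq_count => s /=; rewrite avoiding_cons_bump.
Qed.

Lemma nb_head0 n : nb_head 0 n = nb_avoiding n.
Proof. by apply: eq_count => s; rewrite dodges0 andbT. Qed.

Lemma nb_head_large k n : n <= k.+1 -> nb_head k n = nb_avoiding n.
Proof.
move=> le_nk; apply: eq_in_count => s; rewrite mem_permutations => /perm_iota_all s_lt.
rewrite dodges_le ?andbT //; apply: sub_all s_lt => i /=; lia.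
Qed.

(** The summands count the words with [p] last and those with [p] elsewhere. *)
Lemma nb_headS k p :
  0 < k < p -> nb_head k p.+1 = nb_head k p + nb_avoiding k.
Proof.
move=> kp; have /andP[k_gt0 lt_kp] := kp.
(* Each summand becomes a list of words: [p] is appended to a shorter word, or the run p, ..., k is
   put before an avoider on the letters below [k]. *)
rewrite /nb_head /nb_avoiding -!size_filter -[X in _ = X + _](size_map (rcons^~ p)).
rewrite -(size_map (cat (rev (iota k (p.+1 - k)))) (filter avoiding _)) -size_cat.
apply: perm_size; apply: uniq_perm => [||s].
- by rewrite filter_uniq ?permutations_uniq.
- rewrite cat_uniq !map_inj_uniq ?filter_uniq ?permutations_uniq //=; first 1 last.
  + by move=> s t /eqP; rewrite eqseq_cat // eqxx => /eqP.
  + by move=> s t /rcons_inj[].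
  (* The two lists are disjoint: words of the first end with [p], those of the second with a letter
     below [k], their small part being nonempty as [0 < k]. *)
  rewrite andbT; apply/hasPn=> _ /mapP[s s_in ->]; apply/negP=> /mapP[t _].
  move/(congr1 (last 0)); rewrite last_cat last_rcons.
  move: s_in; rewrite mem_filter mem_permutations => /andP[_ s_perm].
  have s_0 : 0 \in s by rewrite (perm_mem s_perm) mem_iota.
  have := perm_iota_all s_perm; case/lastP: s s_0 {s_perm} => // s x _.
  by rewrite all_rcons last_rcons => /andP[/= ? _]; lia.
rewrite mem_cat mem_filter mem_permutations; apply/andP/orP => [[/andP[av_s dk_s]]|].
  move=> s_perm; have s_p : p \in s by rewrite (perm_mem s_perm) mem_iota /=.
  case/splitPr: s_p av_s dk_s s_perm => s1 [|x s2] av_s dk_s s_perm.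
    left; rewrite cats1 in av_s dk_s s_perm *.
    have s1_perm : perm_eq s1 (iota 0 p).
      by rewrite -(perm_cons p) -perm_rcons (perm_trans s_perm) // -addn1 iotaD cats1 perm_rcons.
    apply: map_f; rewrite mem_filter mem_permutations s1_perm andbT.
    have s1_lt := perm_iota_all s1_perm.
    by rewrite -(avoiding_rcons_max s1_lt) -(dodges_rcons_max k s1_lt) av_s.
  right; have /(descends_form s_perm) := dodges_max_last kp s_perm dk_s isT.
  move: (s1 ++ _) av_s dk_s s_perm => t av_s dk_s s_perm s_eq.
  have r_perm := perm_small (leqW (ltnW lt_kp)) s_perm.
  rewrite {1}s_eq; apply: map_f; rewrite mem_filter mem_permutations r_perm andbT.
  by rewrite -(avoiding_descending_cat (p.+1 - k) (perm_iota_all r_perm)) -s_eq.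
case=> /mapP[r]; rewrite mem_filter mem_permutations.
  case/andP=> /andP[av_r dk_r] r_perm ->; have r_lt := perm_iota_all r_perm.
  rewrite avoiding_rcons_max // dodges_rcons_max // av_r dk_r; split=> //.
  by rewrite perm_rcons -addn1 iotaD perm_sym cats1 perm_rcons perm_cons perm_sym.
case/andP=> av_r r_perm ->; have r_lt := perm_iota_all r_perm.
rewrite avoiding_descending_cat // av_r dodges_descends ?descends_descending_cat //.
by rewrite perm_descending_cat //; lia.
Qed.

(** Splitting off k = 0 and the top one or two values of k leaves the range 1 <= k <= p in both
    first-letter sums, and [nb_headS] compares them there. *)
Lemma nb_avoiding_sum p :
  nb_avoiding p.+3 + 2 * nb_avoiding p.+1 =
  4 * nb_avoiding p.+2 + \sum_(1 <= k < p.+1) nb_avoiding k.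
Proof.
have eq2 : nb_avoiding p.+2 =
    2 * nb_avoiding p.+1 + \sum_(1 <= k < p.+1) nb_head k p.+1.
  rewrite nb_avoidingS big_nat_recr // big_ltn // nb_head0 nb_head_large //=; lia.
have -> : nb_avoiding p.+3 =
    3 * nb_avoiding p.+2 + \sum_(1 <= k < p.+1) nb_head k p.+2.
  rewrite nb_avoidingS 2?big_nat_recr // big_ltn // nb_head0 !nb_head_large //=; lia.
rewrite (eq_big_nat _ _ (F2 := fun k => nb_head k p.+1 + nb_avoiding k)) => [|k].
  by rewrite big_split /=; lia.
exact: nb_headS.
Qed.

(** Subtracting the previous identity at [p] from that at [p.+1] reduces the sums to the single term
    k = p + 1. *)
Lemma nb_avoiding_rec p :
  nb_avoiding p.+4 + 6 * nb_avoiding p.+2 =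
  5 * nb_avoiding p.+3 + 3 * nb_avoiding p.+1.
Proof.
by have := nb_avoiding_sum p; have := nb_avoiding_sum p.+1; rewrite big_nat_recr //=; lia.
Qed.

Lemma nb_avoiding_small :
  [/\ nb_avoiding 0 = 1, nb_avoiding 1 = 1, nb_avoiding 2 = 2 & nb_avoiding 3 = 6].
Proof. by []. Qed.

(** * The generating function *)

Lemma avoid_gfE n :
  avoid_gf [:: [:: 2; 1; 4; 3]; [:: 2; 3; 4; 1]; [:: 2; 4; 1; 3]] n =
  (nb_avoiding n)%:R%R.
Proof.
rewrite /avoid_gf card_avoiders; congr (_%:R)%R.
by apply: eq_count => s; rewrite avoidingE.
Qed.

Import GRing.Theory.
Local Open Scope ring_scope.

(** Brings the few nonzero coefficients of a polynomial factor [b] to the front of the sum, where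
    they can be peeled off. *)
Lemma fps_mul_rev (R : fieldType) (a b : fps R) n :
  fps_mul a b n = \sum_(i < n.+1) a (n - i)%N * b i.
Proof.
rewrite /fps_mul (reindex_inj rev_ord_inj) /=; apply: eq_bigr => i _.
by rewrite subSS subKn // -ltnS.
Qed.

Theorem theorem22 :
  avoid_gf [:: [:: 2; 1; 4; 3]; [:: 2; 3; 4; 1]; [:: 2; 4; 1; 3]]%N
  =1 fps_div (fps_of_poly (1 - 4 *: 'X + 3 *: 'X^2 - 'X^3 : {poly rat}))
             (fps_of_poly (1 - 5 *: 'X + 6 *: 'X^2 - 3 *: 'X^3 : {poly rat})).
Proof.
set q := 1 - 5 *: 'X + _ - _; set p := 1 - 4 *: 'X + _ - _.
have pE i : fps_of_poly p i =
    (i == 0)%:R - 4 * (i == 1)%:R + 3 * (i == 2)%:R - (i == 3)%:R.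
  by rewrite /fps_of_poly /p !coefE.
have qE i : fps_of_poly q i =
    (i == 0)%:R - 5 * (i == 1)%:R + 6 * (i == 2)%:R - 3 * (i == 3)%:R.
  by rewrite /fps_of_poly /q !coefE.
have [a0 a1 a2 a3] := nb_avoiding_small.
apply: fps_div_unique => [|n]; first by rewrite qE.
rewrite fps_mul_rev pE; case: n => [|[|[|n]]].
1,2,3: by rewrite !big_ord_recl big_ord0 /= !avoid_gfE ?a0 ?a1 ?a2 !qE.
(* The denominator has degree 3, so only four terms survive. *)
rewrite 4!big_ord_recl /= big1 => [|i _]; last by rewrite qE /=; lra.
rewrite !avoid_gfE !qE /= /bump /=.
(* The recurrence starts at x^4; at x^3 the initial values give 6 - 10 + 6 - 3 = -1, as in the
   numerator. *)
case: n => [|n]; first by rewrite a0 a1 a2 a3.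
have /(congr1 (fun m => m%:R : rat)) := nb_avoiding_rec n.
rewrite (natrD _ _ (6 * _)) (natrD _ _ (3 * _)) !natrM => rec.
rewrite !addn0 !add1n !subSS !subn0 (_ : (n.+4 == 3) = false) //.
move: rec; rewrite !(mulr0n, mulr1n, mulr0, mulr1); lra.
Qed.
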